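(* Let $p$ be a polygon in $\mathbb{R}^2$, with vertices $v_1, v_2,\ldots,v_n$, edge lengths $l_1,\ldots,l_n\neq 0$ and exterior angles $\theta_1,\ldots,\theta_n$. For each $i\in\{1,\ldots,n\}$, let $n_i$ be the exterior unit normal to the edge $e_i:=(v_i,v_{i+1})$. Under any first-order deformation of $p$, the first-order variations $l'_i$ of its edge lengths and $\theta'_i$ of its exterior angles satisfy the equations: (1) $\sum_{i=1}^n\theta'_i=0$; (2) $\sum_{i=1}^n \bigl(\theta'_i v_i - l'_i n_i\bigr)=0$. Conversely, any first-order variation $(l'_1,\ldots,l'_n,\theta'_1,\ldots,\theta'_n)\in\mathbb{R}^{2n}$ which satisfies these two equations corresponds to a first-order deformation of $p$, which is uniquely defined up to the addition of a trivial deformation.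
   Context: Indices are taken modulo $n$, $l_i$ is the length of $e_i$, and $\theta_i$ is the exterior angle at $v_i$ ($\pi$ minus the interior angle). A first-order deformation of $p$ is a first-order variation of its vertices (vectors of $\mathbb{R}^2$ at the $v_i$); it is trivial if it is induced by an infinitesimal isometry of $\mathbb{R}^2$. *)

(* Defs.v *)
From HB Require Import structures.
From mathcomp Require Import all_boot all_order all_algebra.
From mathcomp Require Import all_classical all_reals all_analysis.
Set Implicit Arguments.
Unset Strict Implicit.
Unset Printing Implicit Defensive.
Import Order.TTheory GRing.Theory Num.Theory.
Import numFieldNormedType.Exports.
Local Open Scope classical_set_scope.
Local Open Scope ring_scope.

Section Plane.
Context {R : realType}.
Implicit Types (x y : 'rV[R]_2) (a : R).

(* The library norm on 'rV[R]_2 is the sup norm, so the Euclidean one has to be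
   introduced separately; both induce the same topology, hence the same
   derivatives of curves. *)
Definition eucl_norm x : R := Num.sqrt (\sum_k x 0 k ^+ 2).

(* counterclockwise rotation by the angle a *)
Definition rot a x : 'rV[R]_2 :=
  \row_k (if k == 0 then cos a * x 0 0 - sin a * x 0 1
          else sin a * x 0 0 + cos a * x 0 1).

Definition is_isometry (f : 'rV[R]_2 -> 'rV[R]_2) : Prop :=
  forall x y, eucl_norm (f x - f y) = eucl_norm (x - y).

(* velocity field at time 0 of a path of isometries starting at the identity *)
Definition infinitesimal_isometry (X : 'rV[R]_2 -> 'rV[R]_2) : Prop :=
  exists F : R -> 'rV[R]_2 -> 'rV[R]_2,
    [/\ forall t, is_isometry (F t),
        forall x, F 0 x = x &
        forall x, is_derive (0 : R) (1 : R) (fun t => F t x) (X x)].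

End Plane.

(* A polygon is given by its vertices v : 'I_n -> 'rV[R]_2 in cyclic order
   together with the side of its edges on which the interior lies: with the
   edges oriented from v_i to v_(i+1), the interior is on the left if s = false
   and on the right if s = true. For an embedded polygon, s is determined by v
   (s = false iff the vertices are in counterclockwise order); for a
   self-intersecting one, some such choice is needed to speak of interior
   angles and exterior normals. *)
Section Polygon.
Context {R : realType} {n : nat}.
Implicit Types (v w : 'I_n -> 'rV[R]_2) (s : bool) (i : 'I_n).

Definition edge v i : 'rV[R]_2 := v (ordS i) - v i.
Definition edge_length v i : R := eucl_norm (edge v i).
Definition edge_dir v i : 'rV[R]_2 := (edge_length v i)^-1 *: edge v i.

Definition exterior_normal v s i : 'rV[R]_2 :=
  rot (- ((-1) ^+ s * (pi / 2))) (edge_dir v i).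

(* Turning the edge leaving v_i, towards the interior side, by the interior
   angle gives the direction from v_i to v_(i-1). This determines the angle
   modulo 2 pi, which is enough to define its variations, also when two
   consecutive edges are folded onto each other. *)
Definition is_interior_angle v s i (a : R) : Prop :=
  rot ((-1) ^+ s * a) (edge_dir v i) = - edge_dir v (ord_pred i).

Definition is_exterior_angle v s i (th : R) : Prop :=
  is_interior_angle v s i (pi - th).

Definition deform v w (t : R) : 'I_n -> 'rV[R]_2 := fun i => v i + t *: w i.

Definition length_variation v w i (l' : R) : Prop :=
  is_derive (0 : R) (1 : R) (fun t => edge_length (deform v w t) i) l'.

(* derivative at 0 of a determination of the exterior angle; it does not depend
   on the determination since two of them that are continuous at 0 differ by a
   constant near 0 *)
Definition angle_variation v s w i (th' : R) : Prop :=
  exists th : R -> R,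
    (\forall t \near (0 : R), is_exterior_angle (deform v w t) s i (th t)) /\
    is_derive (0 : R) (1 : R) th th'.

Definition first_order_variations v s w (l' th' : 'I_n -> R) : Prop :=
  forall i, length_variation v w i (l' i) /\ angle_variation v s w i (th' i).

Definition trivial_deformation v w : Prop :=
  exists X, infinitesimal_isometry X /\ forall i, w i = X (v i).

End Polygon.

(* Main.v *)
Require Import Defs.
From HB Require Import structures.
From mathcomp Require Import all_boot all_order all_algebra.
From mathcomp Require Import all_classical all_reals all_analysis.
From mathcomp Require Import ring lra.
Import Order.TTheory GRing.Theory Num.Theory.
Import numFieldNormedType.Exports.
Local Open Scope ring_scope.

(** Let [u_i] be the unit direction of the edge [e_i = v_(i+1) - v_i], let [J]
    ([perp]) be the quarter turn, and let [eps = 1] or [-1] according to the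
    side of the interior.  Along a deformation [v + t w] the vector [edge w i]
    is the velocity of the edge [e_i]; it splits as
    [a_i u_i + tau_i J e_i], where [a_i] is the rate at which the edge
    stretches and [tau_i] the rate at which its direction turns.  Since the
    exterior angle at [v_i] is, modulo [2 pi] and up to the sign [eps], the
    angle from [e_(i-1)] to [e_i], the variations are
      [l'_i = a_i]   and   [th'_i = eps (tau_i - tau_(i-1))]
    ([first_order_variationsP]).  The theorem is then linear algebra on these
    rates.

    With [th'_i] of this form the first equation is a telescoping sum around
    the polygon, and a summation by parts gives ([closing_identity])
      [sum_i (th'_i v_i - l'_i n_i) = eps J (sum_i (l'_i u_i + tau_i J e_i))].
    For a deformation the sum on the right is the sum of the [edge w i], which
    is zero because the polygon stays closed.

    Conversely, a family with zero sum over the cycle is a family of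
    differences ([cyclic_primitive]).  The first equation thus yields turning
    rates [tau_i], and by the identity above the second one says that the
    prescribed edge velocities [l'_i u_i + tau_i J e_i] have zero sum, hence
    are the [edge w i] of a deformation [w].  The [tau_i] are unique up to a
    common constant [c], which adds [c J e_i] to the edge velocities, that is,
    changes [w] by [c J v_i + b]; these fields are exactly the infinitesimal
    isometries ([infinitesimal_isometryP]).

    The analytic content is that the direction of a moving edge has a
    differentiable angle near time 0 ([polar_lift]), and that the derivative of
    an angle depends only on its cosine and sine
    ([angle_derivative_unique]). *)

(** * Derivatives at a point and differentiable angles *)

Section Calculus.
Context {R : realType}.
Implicit Types (f g x y : R -> R) (d c a : R).

Lemma is_derive_mul f g (t df dg : R) :
  is_derive t (1 : R) f df -> is_derive t (1 : R) g dg ->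
  is_derive t (1 : R) (fun u => f u * g u) (df * g t + f t * dg).
Proof.
move=> hf hg; apply: (@is_derive_eq _ _ _ (f * g)).
by rewrite /GRing.scale /=; ring.
Qed.

Lemma is_derive_scale f c (t df : R) :
  is_derive t (1 : R) f df -> is_derive t (1 : R) (fun u => c * f u) (c * df).
Proof. by move=> hf; apply: (@is_deriveZ _ _ _ f c). Qed.

Lemma is_derive_affine c d (t : R) :
  is_derive t (1 : R) (fun u : R => c + u * d) d.
Proof.
have hM := is_derive_mul id (cst d) t 1 0 (is_derive_id _ _) (is_derive_cst _ _ _).
have := is_deriveD (is_derive_cst c t (1 : R)) hM.
by rewrite add0r mulr0 addr0 mul1r.
Qed.

Lemma near_of_is_derive f (t d : R) (P : set R) :
  is_derive t (1 : R) f d -> nbhs (f t) P -> \forall u \near t, P (f u).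
Proof.
move=> hf; have /derivable1_diffP /differentiable_continuous := @ex_derive _ _ _ _ _ _ _ hf.
exact.
Qed.

Lemma unit_polar c d : c ^+ 2 + d ^+ 2 = 1 -> exists a, cos a = c /\ sin a = d.
Proof.
move=> cd1.
have cB : -1 <= c <= 1 by nra.
have sE : sin (acos c) = `|d|.
  by rewrite sin_acos // -cd1 addrAC subrr add0r sqrtr_sqr.
have [d_ge0|d_lt0] := leP 0 d.
  by exists (acos c); rewrite acosK ?in_itv //= sE ger0_norm.
exists (- acos c); rewrite cosN sinN acosK ?in_itv //= sE ltr0_norm //.
by rewrite opprK.
Qed.

(** After subtracting the initial angle [a], the point stays near angle [0],
    where its angle is the arcsine of its ordinate; this avoids any choice of a
    branch and gives a lift that is differentiable at [0]. *)
Lemma polar_lift x y (x' y' : R) :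
  is_derive (0 : R) (1 : R) x x' -> is_derive (0 : R) (1 : R) y y' ->
  (\forall t \near (0 : R), x t ^+ 2 + y t ^+ 2 = 1) ->
  exists ph : R -> R,
    (\forall t \near (0 : R), cos (ph t) = x t /\ sin (ph t) = y t) /\
    is_derive (0 : R) (1 : R) ph (x 0 * y' - y 0 * x').
Proof.
move=> hx hy xy1.
have [a [ca sa]] := unit_polar _ _ (nbhs_singleton xy1).
(* [(c t, s t)] is the point [(x t, y t)] rotated by [- a], so that it starts
   at [(1, 0)] *)
pose c t := cos a * x t + sin a * y t; pose s t := cos a * y t - sin a * x t.
have a1 := cos2Dsin2 a.
have c0 : c 0 = 1 by rewrite /c -ca -sa -a1; ring.
have s0 : s 0 = 0 by rewrite /s -ca -sa; ring.
have hc : is_derive (0 : R) (1 : R) c (cos a * x' + sin a * y').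
  by apply: is_deriveD; apply: is_derive_scale.
have hs : is_derive (0 : R) (1 : R) s (cos a * y' - sin a * x').
  by apply: is_deriveB; apply: is_derive_scale.
have c_gt0 : \forall t \near (0 : R), 0 < c t.
  apply: (near_of_is_derive _ _ _ (fun z => 0 < z) hc).
  by rewrite c0; exact: lt_nbhsr.
exists (fun t => a + asin (s t)); split.
  near=> t.
  have ct : 0 < c t by near: t.
  have xt : x t ^+ 2 + y t ^+ 2 = 1 by near: t.
  (* as [c t > 0], the arcsine of [s t] has cosine [c t] and not [- c t] *)
  have cs1 : c t ^+ 2 = 1 - s t ^+ 2.
    apply/eqP; rewrite -subr_eq0.
    rewrite (_ : _ - _ = (cos a ^+ 2 + sin a ^+ 2) * (x t ^+ 2 + y t ^+ 2) - 1).
      by rewrite a1 xt mulr1 subrr.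
    by rewrite /c /s; ring.
  have sB : -1 <= s t <= 1 by have := sqr_ge0 (c t); rewrite cs1; move: (s t) => z; nra.
  rewrite cosD sinD cos_asin // asinK ?in_itv //= -cs1 sqrtr_sqr gtr0_norm //.
  split; rewrite -[RHS]mul1r -a1 /c /s; ring.
have hasin : is_derive (s 0) (1 : R) (@asin R) 1.
  have := @is_derive1_asin R (s 0); rewrite s0 expr0n subr0 sqrtr1 invr1.
  by apply; lra.
have := is_deriveD (is_derive_cst a (0 : R) (1 : R)) (is_derive1_comp hasin hs).
by rewrite add0r mul1r ca sa.
Unshelve. all: by end_near. Qed.

(** Neither [f] nor [g] is supposed continuous away from [0], so that [f - g]
    need not be constant near [0]; differentiating the cosine and the sine at
    [0] avoids the question, as one of these has a nonzero derivative there. *)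
Lemma angle_derivative_unique f g (df dg : R) :
  is_derive (0 : R) (1 : R) f df -> is_derive (0 : R) (1 : R) g dg ->
  (\forall t \near (0 : R), cos (f t) = cos (g t) /\ sin (f t) = sin (g t)) ->
  df = dg.
Proof.
move=> hf hg fg.
have [c0 s0] := nbhs_singleton fg.
have hsf : is_derive (0 : R) (1 : R) (fun t => sin (f t)) (cos (f 0) * df).
  exact: (@is_derive1_comp _ sin f).
have hsg : is_derive (0 : R) (1 : R) (fun t => sin (g t)) (cos (g 0) * dg).
  exact: (@is_derive1_comp _ sin g).
have hcf : is_derive (0 : R) (1 : R) (fun t => cos (f t)) (- sin (f 0) * df).
  exact: (@is_derive1_comp _ cos f).
have hcg : is_derive (0 : R) (1 : R) (fun t => cos (g t)) (- sin (g 0) * dg).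
  exact: (@is_derive1_comp _ cos g).
have sfg : cos (f 0) * df = cos (f 0) * dg.
  rewrite {2}c0 -(@derive_val _ _ _ _ _ _ _ hsf) -(@derive_val _ _ _ _ _ _ _ hsg).
  by apply: near_eq_derive; apply: filterS fg => t [].
have cfg : - sin (f 0) * df = - sin (f 0) * dg.
  rewrite {2}s0 -(@derive_val _ _ _ _ _ _ _ hcf) -(@derive_val _ _ _ _ _ _ _ hcg).
  by apply: near_eq_derive; apply: filterS fg => t [].
have {cfg} cfg : sin (f 0) * df = sin (f 0) * dg by apply: oppr_inj; rewrite -!mulNr.
by rewrite -[df]mul1r -[dg]mul1r -(cos2Dsin2 (f 0)) !mulrDl !expr2 -!mulrA sfg cfg.
Qed.

End Calculus.

(** * The Euclidean plane and its infinitesimal isometries *)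

Section Plane.
Context {R : realType}.
Implicit Types (x y z u : 'rV[R]_2) (a c : R).

Definition perp x : 'rV[R]_2 := \row_k (if k == 0 then - x 0 1 else x 0 0).
Definition dot x y : R := x 0 0 * y 0 0 + x 0 1 * y 0 1.

Lemma row2P x y : x 0 0 = y 0 0 -> x 0 1 = y 0 1 -> x = y.
Proof.
move=> e0 e1; apply/rowP => k.
by case: (unliftP 0 k) => [j ->|-> //]; rewrite (ord1 j) (_ : lift _ _ = 1) //; apply: val_inj.
Qed.

Lemma perpE x : (perp x 0 0 = - x 0 1) * (perp x 0 1 = x 0 0).
Proof. by rewrite !mxE. Qed.

Lemma perp_is_linear : linear perp.
Proof. by move=> a x y; apply: row2P; rewrite !(perpE, mxE) //=; ring. Qed.

HB.instance Definition _ :=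
  GRing.isLinear.Build R 'rV[R]_2 'rV[R]_2 *:%R perp perp_is_linear.

Lemma perpK x : perp (perp x) = - x.
Proof. by apply: row2P; rewrite !perpE !mxE. Qed.

Lemma rotE a x : Defs.rot a x = cos a *: x + sin a *: perp x.
Proof. by apply: row2P; rewrite !mxE /=; ring. Qed.

Lemma rotD (a b : R) x : Defs.rot (a + b) x = Defs.rot a (Defs.rot b x).
Proof. by apply: row2P; rewrite !mxE /= cosD sinD; ring. Qed.

Lemma dotC x y : dot x y = dot y x.
Proof. by rewrite /dot; ring. Qed.

Lemma dotDr x y z : dot x (y + z) = dot x y + dot x z.
Proof. by rewrite /dot !mxE; ring. Qed.

Lemma dotZr x c y : dot x (c *: y) = c * dot x y.
Proof. by rewrite /dot !mxE; ring. Qed.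

Lemma dotBr x y z : dot x (y - z) = dot x y - dot x z.
Proof. by rewrite /dot !mxE; ring. Qed.

Lemma dotBl x y z : dot (x - y) z = dot x z - dot y z.
Proof. by rewrite /dot !mxE; ring. Qed.

Lemma dotZl x c y : dot (c *: x) y = c * dot x y.
Proof. by rewrite /dot !mxE; ring. Qed.

Lemma dot_perp x : dot x (perp x) = 0.
Proof. by rewrite /dot !perpE; ring. Qed.

Lemma dot_perp_perp x y : dot (perp x) (perp y) = dot x y.
Proof. by rewrite /dot !perpE; ring. Qed.

Lemma eucl_norm_dot x : eucl_norm x = Num.sqrt (dot x x).
Proof.
rewrite /eucl_norm big_ord_recl big_ord1 /dot -!expr2; congr (Num.sqrt (_ + x 0 _ ^+ 2)).
exact: val_inj.
Qed.

Lemma dot_ge0 x : 0 <= dot x x.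
Proof. by rewrite /dot -!expr2 addr_ge0 ?sqr_ge0. Qed.

Lemma sqr_eucl_norm x : eucl_norm x ^+ 2 = dot x x.
Proof. by rewrite eucl_norm_dot sqr_sqrtr ?dot_ge0. Qed.

(** [x] and [perp x] are orthogonal and have the same length; multiplying by
    [dot x x] gives a statement that also covers [x = 0]. *)
Lemma orthogonal_decomposition x y :
  dot x x *: y = dot x y *: x + dot (perp x) y *: perp x.
Proof. by apply: row2P; rewrite /dot !mxE /=; ring. Qed.

Lemma is_derive_coord (f : R -> 'rV[R]_2) (d : 'rV[R]_2) (k : 'I_2) :
  is_derive (0 : R) (1 : R) f d -> is_derive (0 : R) (1 : R) (fun t => f t 0 k) (d 0 k).
Proof.
move=> hf; have df := @ex_derive _ _ _ _ _ _ _ hf.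
apply: DeriveDef; first exact: (derivable_mxP _ _ _).1.
by rewrite -(@derive_val _ _ _ _ _ _ _ hf) derive_mx // mxE.
Qed.

Lemma is_derive_row2 (f : R -> 'rV[R]_2) (d : 'rV[R]_2) :
  is_derive (0 : R) (1 : R) (fun t => f t 0 0) (d 0 0) ->
  is_derive (0 : R) (1 : R) (fun t => f t 0 1) (d 0 1) ->
  is_derive (0 : R) (1 : R) f d.
Proof.
move=> h0 h1.
have df : derivable f (0 : R) (1 : R).
  apply/derivable_mxP => i j; rewrite (ord1 i).
  have : j = 0 \/ j = 1 by case: j => -[|[|//]] ?; [left|right]; apply: val_inj.
  by case=> ->; [apply: (@ex_derive _ _ _ _ _ _ _ h0) | apply: (@ex_derive _ _ _ _ _ _ _ h1)].
apply: DeriveDef => //; rewrite derive_mx //.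
by apply: row2P; rewrite mxE;
  [exact: (@derive_val _ _ _ _ _ _ _ h0) | exact: (@derive_val _ _ _ _ _ _ _ h1)].
Qed.

Lemma is_derive_dot (f g : R -> 'rV[R]_2) (df dg : 'rV[R]_2) :
  is_derive (0 : R) (1 : R) f df -> is_derive (0 : R) (1 : R) g dg ->
  is_derive (0 : R) (1 : R) (fun t => dot (f t) (g t)) (dot df (g 0) + dot (f 0) dg).
Proof.
move=> hf hg; rewrite (_ : _ + _ = (df 0 0 * g 0 0 0 + f 0 0 0 * dg 0 0) +
  (df 0 1 * g 0 0 1 + f 0 0 1 * dg 0 1)); last by rewrite /dot; ring.
by apply: is_deriveD; apply: is_derive_mul; apply: is_derive_coord.
Qed.

(** The fields [c J x + b] are the velocities of the motions
    [rot (t c) x + t b].  Conversely, differentiating the squared distance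
    between two moving points gives the Killing equation
    [dot (x - y) (X x - X y) = 0]; so [X - X 0] is skew for the scalar product,
    and a skew map is determined by its values on an orthonormal basis, which
    makes it linear. *)
Lemma infinitesimal_isometryP (X : 'rV[R]_2 -> 'rV[R]_2) :
  infinitesimal_isometry X <-> exists c b, forall x, X x = c *: perp x + b.
Proof.
split=> [[F [isoF F0 dF]]|[c [b XE]]]; last first.
  exists (fun t x => Defs.rot (t * c) x + t *: b); split.
  - move=> t x y; rewrite !eucl_norm_dot; congr Num.sqrt.
    rewrite opprD addrACA subrr addr0 -[RHS]mul1r -(cos2Dsin2 (t * c)).
    by rewrite /dot !mxE /=; ring.
  - by move=> x; rewrite mul0r scale0r addr0 rotE cos0 sin0 scale1r scale0r addr0.
  move=> x.
  have hl : is_derive (0 : R) (1 : R) (fun t => t * c) c.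
    have := is_derive_affine 0 c 0.
    by congr is_derive; apply: funext => t; rewrite add0r.
  have hc : is_derive (0 : R) (1 : R) (fun t => cos (t * c)) 0.
    have := @is_derive1_comp _ cos _ _ _ _ (is_derive_cos _) hl.
    by rewrite mul0r sin0 oppr0 mul0r.
  have hs : is_derive (0 : R) (1 : R) (fun t => sin (t * c)) c.
    have := @is_derive1_comp _ sin _ _ _ _ (is_derive_sin _) hl.
    by rewrite mul0r cos0 mul1r.
  have hk k : is_derive (0 : R) (1 : R) (fun t => (Defs.rot (t * c) x + t *: b) 0 k) (X x 0 k).
    have hck := is_derive_scale _ (x 0 k) _ _ hc.
    have hsk := is_derive_scale _ (perp x 0 k) _ _ hs.
    have hD := is_deriveD (is_deriveD hck hsk) (is_derive_affine 0 (b 0 k) 0).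
    rewrite (_ : X x 0 k = x 0 k * 0 + perp x 0 k * c + b 0 k); last first.
      by rewrite XE mulr0 add0r !mxE mulrC.
    rewrite (_ : (fun t => _) = (fun t => x 0 k * cos (t * c) +
      perp x 0 k * sin (t * c) + (0 + t * b 0 k))); first exact: hD.
    by apply: funext => t; rewrite rotE !mxE; ring.
  by apply: is_derive_row2; exact: hk.
have killing x y : dot (x - y) (X x - X y) = 0.
  have hd : is_derive (0 : R) (1 : R) (fun t => F t x - F t y) (X x - X y).
    exact: is_deriveB.
  have := is_derive_dot _ _ _ _ hd hd.
  rewrite !F0 (_ : (fun t => _) = cst (dot (x - y) (x - y))); last first.
    by apply: funext => t; rewrite -!sqr_eucl_norm isoF.
  move=> hcst; have := @derive_val _ _ _ _ _ _ _ hcst.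
  rewrite derive_cst (dotC _ (x - y)) => /esym /eqP.
  by rewrite -mulr2n mulrn_eq0 /= => /eqP.
pose Y x := X x - X 0.
have YX x : dot x (Y x) = 0 by have := killing x 0; rewrite subr0.
have Yskew x y : dot x (Y y) + dot y (Y x) = 0.
  have := killing x y; rewrite (_ : X x - X y = Y x - Y y); last first.
    by rewrite /Y opprB addrA subrK.
  rewrite dotBl (dotBr x) (dotBr y) (YX x) (YX y) subr0 sub0r -opprD => /eqP.
  by rewrite oppr_eq0 => /eqP.
(* the coordinates of [Y x] are [dot e1 (Y x) = - dot x (Y e1)] and
   [dot e2 (Y x) = - dot x (Y e2)] *)
pose e1 : 'rV[R]_2 := \row_k (k == 0)%:R.
have e1E : (e1 0 0 = 1) * (e1 0 1 = 0) by rewrite !mxE.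
pose e2 := perp e1.
exists (Y e1 0 1), (X 0) => x.
rewrite -[LHS](subrK (X 0)) -/(Y x); congr (_ + _).
have h11 := YX e1; have h22 := YX e2; have h12 := Yskew e1 e2.
have h1 := Yskew e1 x; have h2 := Yskew e2 x.
move: h11 h22 h12 h1 h2; rewrite /dot /e2 !perpE !e1E !oppr0 !mul0r !mul1r !addr0 !add0r.
move=> h11 h22 h12 h1 h2; rewrite h11 h22 in h1 h2 *.
by apply: row2P; rewrite [RHS]mxE perpE; [lra|nra].
Qed.

End Plane.

(** * Functions on a finite cycle *)

Section Cyclic.
Context {V : zmodType} {n : nat}.
Implicit Types f g : 'I_n -> V.

Lemma cyclic_constant f : (forall i, f (ordS i) = f i) -> exists c, forall i, f i = c.
Proof.
case: n f => [|m] f fS; first by exists 0; case.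
exists (f ord0) => -[k]; elim: k => [|k IH] lt_km; first by congr (f _); apply: val_inj.
rewrite -(IH (ltnW lt_km)) -[RHS]fS; congr (f _); apply: val_inj => /=.
by rewrite modn_small.
Qed.

(** The partial sums from [0] are a primitive; the only equation which is not
    a step of these sums is the one that closes the cycle, and it says that the
    total is zero. *)
Lemma cyclic_primitive f : \sum_i f i = 0 -> exists g, forall i, g (ordS i) - g i = f i.
Proof.
move=> f0; exists (fun i => \sum_(j < n | (j < i)%N) f j) => i.
apply/eqP; rewrite subr_eq; apply/eqP; transitivity (\sum_(j < n | (j <= i)%N) f j).
  have [lt_iSn|le_niS] := ltnP i.+1 n.
    by apply: eq_bigl => j /=; rewrite modn_small.
  (* [i] is the last index: the left-hand side is the empty sum *)
  have -> : nat_of_ord (ordS i) = 0%N.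
    by rewrite /= (_ : i.+1 = n) ?modnn //; apply/eqP; rewrite eqn_leq ltn_ord.
  rewrite big_pred0 // -[LHS]f0; apply: eq_bigl => j.
  by rewrite -ltnS (leq_trans (ltn_ord j)).
rewrite (bigD1 i) //=; congr (_ + _); apply: eq_bigl => j.
by rewrite [RHS]ltn_neqAle andbC.
Qed.

Lemma cyclic_sum_shift f : \sum_i f (ordS i) = \sum_i f i.
Proof. by rewrite [RHS](reindex_inj (@ordS_inj n)). Qed.

End Cyclic.

(** * Exterior angles as differences of directions *)

Section Directions.
Context {R : realType}.
Implicit Types a b : R.

Definition direction a : 'rV[R]_2 := Defs.rot a (\row_k (k == 0)%:R).

Lemma directionE a : (direction a 0 0 = cos a) * (direction a 0 1 = sin a).
Proof. by rewrite !mxE /= !mulr1 !mulr0 subr0 addr0. Qed.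

Lemma rot_direction a b : Defs.rot a (direction b) = direction (a + b).
Proof. by rewrite /direction rotD. Qed.

Lemma direction_half_turn (s : bool) a : direction ((-1) ^+ s * pi + a) = - direction a.
Proof.
apply: row2P; rewrite [RHS]mxE !directionE ?cosD ?sinD;
by case: s; rewrite ?expr0 ?expr1 ?mul1r ?mulN1r ?cosN ?sinN cospi sinpi; ring.
Qed.

(** Turning [u_i] by [eps (pi - th)] gives [- u_(i-1)] exactly when turning it
    by [- eps th] gives [u_(i-1)].  Equality of directions is equality of
    angles modulo [2 pi]. *)
Lemma is_exterior_angle_direction n (v : 'I_n -> 'rV[R]_2) s i (a b th : R) :
  edge_dir v i = direction a -> edge_dir v (ord_pred i) = direction b ->
  is_exterior_angle v s i th <-> direction ((-1) ^+ s * th) = direction (a - b).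
Proof.
move=> ea eb; rewrite /is_exterior_angle /is_interior_angle ea eb rot_direction.
set e := (-1) ^+ s; rewrite (_ : e * (pi - th) + a = e * pi + (a - e * th)); last by ring.
rewrite direction_half_turn; split=> [/oppr_inj ab|ab].
  have := congr1 (Defs.rot (e * th - b)) ab; rewrite !rot_direction subrK => <-.
  by congr direction; ring.
have := congr1 (Defs.rot (b - e * th)) ab; rewrite !rot_direction subrK => ->.
by congr (- direction _); ring.
Qed.

End Directions.

(** * Variations of lengths and angles *)

Section Variations.
Context {R : realType} {n : nat}.
Implicit Types (v w : 'I_n -> 'rV[R]_2) (i : 'I_n) (s : bool).

Definition stretching_speed v w i : R := dot (edge_dir v i) (edge w i).
(** The angular velocity of the direction of the edge. *)
Definition turning_speed v w i : R :=
  dot (perp (edge v i)) (edge w i) / edge_length v i ^+ 2.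

Lemma edge_deform v w t i : edge (deform v w t) i = edge v i + t *: edge w i.
Proof. by rewrite /edge /deform scalerBr opprD addrACA. Qed.

Lemma edgeB v w i : edge (fun j => v j - w j) i = edge v i - edge w i.
Proof. by rewrite /edge !opprD addrACA. Qed.

Lemma dot_edge_dir v i : edge_length v i != 0 -> dot (edge_dir v i) (edge_dir v i) = 1.
Proof.
move=> l0; rewrite dotZl dotZr -sqr_eucl_norm -/(edge_length v i).
by field.
Qed.

Lemma is_derive_line (x y : 'rV[R]_2) : is_derive (0 : R) (1 : R) (fun t => x + t *: y) y.
Proof.
have hk k : is_derive (0 : R) (1 : R) (fun t : R => (x + t *: y) 0 k) (y 0 k).
  rewrite (_ : (fun t => _) = (fun t => x 0 k + t * y 0 k)); first exact: is_derive_affine.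
  by apply: funext => t; rewrite !mxE.
by apply: is_derive_row2; exact: hk.
Qed.

Lemma is_derive_edge_length v w i : edge_length v i != 0 ->
  is_derive (0 : R) (1 : R) (fun t => edge_length (deform v w t) i) (stretching_speed v w i).
Proof.
move=> l_neq0; set e := edge v i; set d := edge w i.
have hq : is_derive (0 : R) (1 : R) (fun t => dot (e + t *: d) (e + t *: d)) (2 * dot e d).
  have := is_derive_dot _ _ _ _ (is_derive_line e d) (is_derive_line e d).
  by rewrite scale0r addr0 (dotC d) -mulr2n mulr_natl.
have q_gt0 : 0 < dot e e.
  by rewrite -sqr_eucl_norm exprn_even_gt0.
have hsqrt : is_derive (dot (e + (0 : R) *: d) (e + (0 : R) *: d)) (1 : R) Num.sqrt
    (2 * edge_length v i)^-1.
  rewrite scale0r addr0 /edge_length eucl_norm_dot; exact: is_derive1_sqrt.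
have := @is_derive1_comp _ Num.sqrt (fun t => dot (e + t *: d) (e + t *: d)) _ _ _ hsqrt hq.
rewrite (_ : _ \o _ = fun t => edge_length (deform v w t) i); last first.
  by apply: funext => t; rewrite /= /edge_length edge_deform eucl_norm_dot.
rewrite (_ : (2 * edge_length v i)^-1 * _ = stretching_speed v w i) //.
by rewrite /stretching_speed /edge_dir dotZl -/e -/d; field.
Qed.

(** The velocity of a differentiable angle of [(x, y)] is [x y' - y x'].  The
    part of the velocity of [u_i] that comes from the change of length is along
    [u_i] and contributes nothing, which leaves the component of [edge w i]
    along [J e_i]. *)
Lemma edge_dir_polar v w i : edge_length v i != 0 ->
  exists ph : R -> R,
    (\forall t \near (0 : R), edge_dir (deform v w t) i = direction (ph t)) /\
    is_derive (0 : R) (1 : R) ph (turning_speed v w i).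
Proof.
move=> l_neq0; set e := edge v i; set d := edge w i.
pose l (t : R) := edge_length (deform v w t) i.
have l0 : l 0 = edge_length v i.
  by rewrite /l /edge_length edge_deform scale0r addr0.
have hl : is_derive (0 : R) (1 : R) l (stretching_speed v w i).
  exact: is_derive_edge_length.
have hu k : is_derive (0 : R) (1 : R) (fun t => edge_dir (deform v w t) i 0 k)
    (- (l 0) ^- 2 * stretching_speed v w i * e 0 k + (l 0)^-1 * d 0 k).
  have hV : is_derive (0 : R) (1 : R) (fun t => (l t)^-1) (- l 0 ^- 2 * stretching_speed v w i).
    by apply: is_deriveV; rewrite l0.
  have := is_derive_mul _ _ _ _ _ hV (is_derive_affine (e 0 k) (d 0 k) 0).
  rewrite mul0r addr0 (_ : (fun u => _) = fun t => edge_dir (deform v w t) i 0 k) //.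
  by apply: funext => t; rewrite /edge_dir -/(l t) edge_deform !mxE.
have l_neq : \forall t \near (0 : R), l t != 0.
  apply: (near_of_is_derive _ _ _ (fun z => z != 0) hl).
  by apply: open_nbhs_nbhs; split; [exact: open_neq | rewrite l0].
have [|ph [phE dph]] := polar_lift _ _ _ _ (hu 0) (hu 1).
  by apply: filterS l_neq => t lt; rewrite !expr2; exact: dot_edge_dir.
exists ph; split.
  by apply: filterS phE => t [c s]; apply: row2P; rewrite directionE.
apply: (is_derive_eq dph).
rewrite (_ : deform v w 0 = v); last first.
  by apply: funext => j; rewrite /deform scale0r addr0.
have uE k : edge_dir v i 0 k = (edge_length v i)^-1 * e 0 k by rewrite mxE.
by rewrite /turning_speed /dot !perpE -/e -/d !uE l0; field.
Qed.

(** The difference of the lifted angles of [u_i] and [u_(i-1)] provides one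
    determination of the exterior angle, and all determinations have the same
    derivative. *)
Lemma angle_variationP v s w i (th' : R) :
  (forall j, edge_length v j != 0) ->
  angle_variation v s w i th' <->
  th' = (-1) ^+ s * (turning_speed v w i - turning_speed v w (ord_pred i)).
Proof.
move=> hl; have [ph [phE dph]] := edge_dir_polar v w i (hl i).
have [qh [qhE dqh]] := edge_dir_polar v w (ord_pred i) (hl _).
have dg : is_derive (0 : R) (1 : R) (fun t => ph t - qh t)
    (turning_speed v w i - turning_speed v w (ord_pred i)).
  exact: is_deriveB.
have ee : (-1) ^+ s * (-1) ^+ s = 1 :> R by rewrite -expr2 sqrr_sign.
split=> [[th [thE dth]]|->].
  have df := is_derive_scale _ ((-1) ^+ s) _ _ dth.
  rewrite -(angle_derivative_unique _ _ _ _ df dg) ?mulrA ?ee ?mul1r //.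
  near=> t.
  have pt : edge_dir (deform v w t) i = direction (ph t) by near: t.
  have qt : edge_dir (deform v w t) (ord_pred i) = direction (qh t) by near: t.
  have tt : is_exterior_angle (deform v w t) s i (th t) by near: t.
  have /rowP E := (is_exterior_angle_direction _ _ _ _ _ _ _ pt qt).1 tt.
  by have := E 0; have := E 1; rewrite !directionE.
exists (fun t => (-1) ^+ s * (ph t - qh t)); split; last exact: is_derive_scale.
near=> t.
have pt : edge_dir (deform v w t) i = direction (ph t) by near: t.
have qt : edge_dir (deform v w t) (ord_pred i) = direction (qh t) by near: t.
by apply/(is_exterior_angle_direction _ _ _ _ _ _ _ pt qt); rewrite mulrA ee mul1r.
Unshelve. all: by end_near. Qed.

Lemma first_order_variationsP v s w (l' th' : 'I_n -> R) :
  (forall i, edge_length v i != 0) ->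
  first_order_variations v s w l' th' <->
  (forall i, l' i = stretching_speed v w i /\
     th' i = (-1) ^+ s * (turning_speed v w i - turning_speed v w (ord_pred i))).
Proof.
move=> hl; split=> H i; have [h1 h2] := H i; split.
- have dl := is_derive_edge_length v w i (hl i).
  by rewrite -(@derive_val _ _ _ _ _ _ _ h1) (@derive_val _ _ _ _ _ _ _ dl).
- exact/(angle_variationP v s w i _ hl).
- by rewrite h1; exact: is_derive_edge_length.
- exact/(angle_variationP v s w i _ hl).
Qed.

Lemma edge_edge_dir v i : edge_length v i != 0 ->
  edge v i = edge_length v i *: edge_dir v i.
Proof. by move=> l0; rewrite scalerA divff // scale1r. Qed.

Lemma edge_decomposition v w i : edge_length v i != 0 ->
  edge w i = stretching_speed v w i *: edge_dir v i + turning_speed v w i *: perp (edge v i).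
Proof.
move=> l0; have := orthogonal_decomposition (edge v i) (edge w i).
rewrite -sqr_eucl_norm -/(edge_length v i) => /(congr1 ( *:%R (edge_length v i ^- 2))).
rewrite scalerA mulVf ?expf_neq0 // scale1r => ->.
rewrite scalerDr !scalerA /stretching_speed /turning_speed dotZl.
by congr (_ *: _ + _ *: _); field.
Qed.

(** Converse of [edge_decomposition]: prescribing the velocities of the edges
    in this form prescribes the rates. *)
Lemma speeds_of_decomposition v w i (a c : R) : edge_length v i != 0 ->
  edge w i = a *: edge_dir v i + c *: perp (edge v i) ->
  stretching_speed v w i = a /\ turning_speed v w i = c.
Proof.
move=> l0 wE; rewrite /stretching_speed /turning_speed {}wE.
have perp_edge : perp (edge v i) = edge_length v i *: perp (edge_dir v i).
  by rewrite {1}edge_edge_dir // linearZ.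
move: (edge_dir v i) (dot_edge_dir v i l0) perp_edge => u uu perp_edge.
have pu : dot (perp u) u = 0 by rewrite dotC dot_perp.
rewrite perp_edge dotZl !dotDr !dotZr dot_perp_perp dot_perp pu uu.
by split; field.
Qed.

Lemma exterior_normalE v s i :
  exterior_normal v s i = - ((-1) ^+ s *: perp (edge_dir v i)).
Proof.
rewrite /exterior_normal rotE cosN sinN.
by case: s; rewrite ?expr0 ?expr1 ?mul1r ?mulN1r ?cosN ?sinN
  cos_pihalf sin_pihalf scale0r add0r ?opprK ?scale1r ?scaleN1r ?opprK.
Qed.

(** Summation by parts: in [sum_i (om_i - om_(i-1)) v_i] the rate [om_i]
    appears with the coefficient [v_i - v_(i+1) = - e_i = J (J e_i)], while
    [- n_i = eps J u_i].  It holds for arbitrary numbers [om_i], which allows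
    reading it in both directions. *)
Lemma closing_identity v s (l' om : 'I_n -> R) :
  \sum_i (((-1) ^+ s * (om i - om (ord_pred i))) *: v i - l' i *: exterior_normal v s i)
  = (-1) ^+ s *: perp (\sum_i (l' i *: edge_dir v i + om i *: perp (edge v i))).
Proof.
rewrite linear_sum scaler_sumr.
rewrite (eq_bigr (fun i => ((-1) ^+ s *: (om i *: v i) - (-1) ^+ s *: (om (ord_pred i) *: v i)) +
  (-1) ^+ s *: (l' i *: perp (edge_dir v i)))); last first.
  move=> i _; rewrite exterior_normalE scalerN opprK; congr (_ + _).
    by rewrite mulrBr scalerBl !scalerA.
  by rewrite !scalerA mulrC.
rewrite big_split sumrB /= -[X in _ - X]cyclic_sum_shift.
under [X in _ - X]eq_bigr do rewrite ordSK.
rewrite -sumrB -big_split /=; apply: eq_bigr => i _.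
rewrite linearD (linearZ_LR perp (l' i)) (linearZ_LR perp (om i)) /= perpK.
by rewrite scalerDr [RHS]addrC -!scalerBr opprB.
Qed.

Lemma sum_edge w : \sum_i edge w i = 0.
Proof. by rewrite sumrB cyclic_sum_shift subrr. Qed.

Lemma trivial_deformationP v w :
  trivial_deformation v w <-> exists c, forall i, edge w i = c *: perp (edge v i).
Proof.
split=> [[X [/infinitesimal_isometryP [c [b XE]] wX]]|[c wc]].
  by exists c => i; rewrite /edge !wX !XE linearB scalerBr /= opprD addrACA subrr addr0.
have [|b wb] := cyclic_constant (fun i => w i - c *: perp (v i)).
  move=> i; apply/eqP; rewrite -subr_eq0 opprD addrACA -/(edge w i) wc opprK.
  by rewrite /edge linearB scalerBr /= addrACA addrN addNr addr0.
exists (fun x => c *: perp x + b); split.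
  by apply/infinitesimal_isometryP; exists c, b.
by move=> i; rewrite -(wb i) addrC subrK.
Qed.

End Variations.

(** * Variations that come from a deformation *)

Theorem theorem1p2 (R : realType) (n : nat) (v : 'I_n -> 'rV[R]_2) (s : bool)
    (hl : forall i, edge_length v i != 0) :
  [/\ forall w : 'I_n -> 'rV[R]_2,
        exists l' th' : 'I_n -> R, first_order_variations v s w l' th',
      forall (w : 'I_n -> 'rV[R]_2) (l' th' : 'I_n -> R),
        first_order_variations v s w l' th' ->
        \sum_i th' i = 0 /\
        \sum_i (th' i *: v i - l' i *: exterior_normal v s i) = 0
    & forall l' th' : 'I_n -> R,
        \sum_i th' i = 0 ->
        \sum_i (th' i *: v i - l' i *: exterior_normal v s i) = 0 ->
        exists w : 'I_n -> 'rV[R]_2, forall w' : 'I_n -> 'rV[R]_2,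
          first_order_variations v s w' l' th' <->
          trivial_deformation v (fun i => w' i - w i)].
Proof.
have ee : (-1) ^+ s * (-1) ^+ s = 1 :> R by rewrite -expr2 sqrr_sign.
split.
- move=> w; exists (stretching_speed v w).
  exists (fun i => (-1) ^+ s * (turning_speed v w i - turning_speed v w (ord_pred i))).
  exact/first_order_variationsP.
- move=> w l' th' /(first_order_variationsP v s w l' th' hl) H; split.
    rewrite (eq_bigr _ (fun i _ => (H i).2)) -mulr_sumr sumrB.
    rewrite -[X in _ - X]cyclic_sum_shift.
    by under [X in _ - X]eq_bigr do rewrite ordSK; rewrite subrr mulr0.
  under eq_bigr do rewrite (H _).1 (H _).2.
  rewrite closing_identity (eq_bigr (edge w)) ?sum_edge ?linear0 ?scaler0 //.
  by move=> i _; rewrite -edge_decomposition.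
move=> l' th' th0 lth0.
(* the turning rates, by integration of the angle variations; the shift by
   [ordS] matches [tau_i - tau_(i-1)] with the form of [cyclic_primitive] *)
have [|om omE] := cyclic_primitive (fun i => (-1) ^+ s * th' (ordS i)).
  by rewrite -mulr_sumr cyclic_sum_shift th0 mulr0.
have thE i : th' i = (-1) ^+ s * (om i - om (ord_pred i)).
  by have := omE (ord_pred i); rewrite ord_predK => ->; rewrite mulrA ee mul1r.
(* the edge velocities that these rates impose close up *)
have [|w wE] := cyclic_primitive (fun i => l' i *: edge_dir v i + om i *: perp (edge v i)).
  move: lth0; under eq_bigr do rewrite thE.
  rewrite closing_identity => /(congr1 ( *:%R ((-1) ^+ s))).
  rewrite scalerA ee scale1r scaler0 => /(congr1 perp).
  by rewrite perpK linear0 => /eqP; rewrite oppr_eq0 => /eqP.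
have wS i : stretching_speed v w i = l' i /\ turning_speed v w i = om i.
  by apply: (speeds_of_decomposition v w i _ _ (hl i)); exact: wE.
exists w => w'.
(* both sides say that [tau_i] for [w'] exceeds [om_i] by a constant and that
   the stretching rates agree *)
apply: (iff_trans (first_order_variationsP v s w' l' th' hl)).
apply: iff_sym; apply: (iff_trans (trivial_deformationP _ _)); split.
  move=> [c cE].
  have w'S i : stretching_speed v w' i = l' i /\ turning_speed v w' i = om i + c.
    apply: (speeds_of_decomposition v w' i _ _ (hl i)).
    have /eqP := cE i; rewrite edgeB subr_eq => /eqP ->.
    by rewrite [edge w i]wE scalerDl [RHS]addrA [LHS]addrC.
  by move=> i; rewrite (w'S i).1 !(w'S _).2 thE; split=> //; congr (_ * _); ring.
move=> H.
have [|c cE] := cyclic_constant (fun i => turning_speed v w' i - om i).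
  move=> i; have := (H (ordS i)).2; rewrite thE ordSK => /(congr1 ( *%R ((-1) ^+ s))).
  rewrite !mulrA ee !mul1r => E.
  by lra.
exists c => i; rewrite edgeB (edge_decomposition v w' i (hl i)) [edge w i]wE -(H i).1 -(cE i).
by rewrite scalerBl opprD addrACA subrr add0r.
Qed.
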